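(* Let $q$ be a prime power and $n\ge2$. Let $H_n(q)$ be the Hecke algebra corresponding to the $\mathcal B\backslash GL_n(q)/\mathcal B$ double cosets and let $D=\sum_{T\in\mathcal T_{n,q}}T$ be the sum of all transvections, regarded as an element of $H_n(q)$. Then $$D=(n-1)q^{n-1}-[n-1]_q+(q-1)\sum_{1\le i<j\le n}q^{\,n-1-(j-i)}\,T_{ij},$$ where scalars denote multiples of the unit of $H_n(q)$ and $T_{ij}\in H_n(q)$ is the basis element $T_\omega$ for the transposition $\omega=(i,j)$.
   Context: $G=GL_n(q)$ is the group of invertible $n\times n$ matrices over $\mathbb F_q$ and $\mathcal B$ is the subgroup of upper triangular matrices. $\mathbb C[G]$ is the complex group algebra. Put $\mathbb 1_{\mathcal B}=\frac1{|\mathcal B|}\sum_{x\in\mathcal B}x$ and, for $\omega\in S_n$ (identified with its permutation matrix), $T_\omega=\frac1{|\mathcal B|}\sum_{x\in\mathcal B\omega\mathcal B}x$. The Hecke algebra is $H_n(q)=\mathbb 1_{\mathcal B}\mathbb C[G]\mathbb 1_{\mathcal B}$, with unit $\mathbb 1_{\mathcal B}$ and basis $\{T_\omega:\omega\in S_n\}$. A transvection is a matrix $I+\mathbf v\mathbf a^\top$ with $\mathbf a,\mathbf v\in\mathbb F_q^n$ nonzero and $\mathbf a^\top\mathbf v=0$; $\mathcal T_{n,q}$ is the set of all transvections, which is a conjugacy class of $G$, so $\sum_{T\in\mathcal T_{n,q}}T$ is central in $\mathbb C[G]$. It is regarded as an element of $H_n(q)$ via multiplication by $\mathbb 1_{\mathcal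 B}$, i.e. $D$ in $H_n(q)$ means $\left(\sum_{T\in\mathcal T_{n,q}}T\right)\mathbb 1_{\mathcal B}$. $[k]_q=(q^k-1)/(q-1)$. *)

(* Defs.v *)
From HB Require Import structures.
From mathcomp Require Import all_boot all_order all_algebra all_fingroup.
From mathcomp Require Import falgebra.

Set Implicit Arguments.
Unset Strict Implicit.
Unset Printing Implicit Defensive.

Import Order.TTheory GRing.Theory Num.Theory.

Local Open Scope ring_scope.

(* The alias keeps the convolution product apart from the pointwise product   *)
(* that {ffun gT -> K} inherits from K.                                        *)
Definition groupAlg (K : fieldType) (gT : finGroupType) : Type :=
  {ffun gT -> K^o}.

HB.instance Definition _ (K : fieldType) (gT : finGroupType) :=
  Vector.copy (groupAlg K gT) {ffun gT -> K^o}.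

Section GroupAlgebra.

Variables (K : fieldType) (gT : finGroupType).
Implicit Types (u v w : groupAlg K gT) (x y g h : gT).

Definition ga_elt g : groupAlg K gT := [ffun x => (x == g)%:R].

Definition ga_mul u v : groupAlg K gT :=
  [ffun x => \sum_y u y * v (y^-1 * x)%g].

Fact ga_mulA : associative ga_mul.
Proof.
move=> u v w; apply/ffunP=> x; rewrite !ffunE.
under eq_bigr => y _ do rewrite ffunE mulr_sumr.
under [RHS]eq_bigr => y _ do rewrite ffunE mulr_suml.
rewrite [RHS]exchange_big /=; apply: eq_bigr => y _.
rewrite [RHS](reindex_inj (mulgI y)) /=; apply: eq_bigr => z _.
by rewrite mulrA mulKg invMg mulgA.
Qed.

Fact ga_mul1l : left_id (ga_elt 1%g) ga_mul.
Proof.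
move=> u; apply/ffunP=> x; rewrite ffunE (bigD1 1%g) //= ffunE eqxx mul1r.
rewrite invg1 mul1g big1 ?addr0 // => y /negPf nt_y.
by rewrite ffunE nt_y mul0r.
Qed.

Fact ga_mul1r : right_id (ga_elt 1%g) ga_mul.
Proof.
move=> u; apply/ffunP=> x; rewrite ffunE (bigD1 x) //= ffunE mulVg eqxx mulr1.
rewrite big1 ?addr0 // => y neq_yx.
by rewrite ffunE -eq_mulVg1 (negPf neq_yx) mulr0.
Qed.

Fact ga_mulDl : left_distributive ga_mul +%R.
Proof.
move=> u v w; apply/ffunP=> x; rewrite !ffunE -big_split /=.
by apply: eq_bigr => y _; rewrite ffunE mulrDl.
Qed.

Fact ga_mulDr : right_distributive ga_mul +%R.
Proof.
move=> u v w; apply/ffunP=> x; rewrite !ffunE -big_split /=.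
by apply: eq_bigr => y _; rewrite ffunE mulrDr.
Qed.

Fact ga_oner_neq0 : ga_elt 1%g != 0.
Proof.
by apply/eqP=> /ffunP/(_ 1%g); rewrite !ffunE eqxx; apply/eqP/oner_neq0.
Qed.

HB.instance Definition _ := GRing.Zmodule_isNzRing.Build (groupAlg K gT)
  ga_mulA ga_mul1l ga_mul1r ga_mulDl ga_mulDr ga_oner_neq0.

Fact ga_scaleAl (a : K) u v : a *: (u * v) = (a *: u) * v.
Proof.
apply/ffunP=> x; rewrite !ffunE scaler_sumr.
by apply: eq_bigr => y _; rewrite !ffunE scalerAl.
Qed.

HB.instance Definition _ :=
  GRing.Lmodule_isLalgebra.Build K (groupAlg K gT) ga_scaleAl.

Fact ga_scaleAr (a : K) u v : a *: (u * v) = u * (a *: v).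
Proof.
apply/ffunP=> x; rewrite !ffunE scaler_sumr.
by apply: eq_bigr => y _; rewrite !ffunE scalerAr.
Qed.

HB.instance Definition _ :=
  GRing.Lalgebra_isAlgebra.Build K (groupAlg K gT) ga_scaleAr.

HB.instance Definition _ := Algebra_isFalgebra.Build K (groupAlg K gT).

Lemma ga_eltM g h : ga_elt g * ga_elt h = ga_elt (g * h)%g.
Proof.
apply/ffunP=> x; rewrite !ffunE (bigD1 g) //= !ffunE eqxx mul1r big1 ?addr0.
  by rewrite -(inj_eq (mulgI g)) mulKVg.
by move=> y /negPf neq_yg; rewrite ffunE neq_yg mul0r.
Qed.

Lemma ga_elt1 : ga_elt 1%g = 1. Proof. by []. Qed.

Definition ga_sum (A : {set gT}) : groupAlg K gT := \sum_(x in A) ga_elt x.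

Lemma ga_eltM_sum g A : ga_elt g * ga_sum A = ga_sum (g *: A)%g.
Proof.
rewrite /ga_sum mulr_sumr -[(g *: A)%g]lcosetE big_imset /=; last first.
  by move=> y z _ _ /mulgI.
by apply: eq_bigr => y _; rewrite ga_eltM.
Qed.

Lemma ga_sumM_elt g A : ga_sum A * ga_elt g = ga_sum (A :* g)%g.
Proof.
rewrite /ga_sum mulr_suml -[(A :* g)%g]rcosetE big_imset /=; last first.
  by move=> y z _ _ /mulIg.
by apply: eq_bigr => y _; rewrite ga_eltM.
Qed.

Lemma ga_sum_central A :
  (forall g, A :^ g = A)%g -> forall u, u * ga_sum A = ga_sum A * u.
Proof.
move=> normA u.
have commA g : ga_elt g * ga_sum A = ga_sum A * ga_elt g.
  by rewrite ga_eltM_sum ga_sumM_elt -{1}(normA g) conjsgE lcosetKV.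
have ->: u = \sum_g u g *: ga_elt g.
  apply/ffunP=> x; rewrite sum_ffunE (bigD1 x) //= !ffunE eqxx big1 ?addr0.
    by rewrite /GRing.scale /= mulr1.
  by move=> y /negPf neq_yx; rewrite !ffunE eq_sym neq_yx scaler0.
rewrite mulr_suml mulr_sumr; apply: eq_bigr => g _.
by rewrite -scalerAl commA scalerAr.
Qed.

End GroupAlgebra.

Section HeckePair.

Variables (C : numFieldType) (gT : finGroupType) (B : {group gT}).

Local Notation CG := (groupAlg C gT).

Definition avg_idem : CG := #|B|%:R^-1 *: ga_sum C B.

Let cardB_neq0 : #|B|%:R != 0 :> C.
Proof. by rewrite pnatr_eq0 -lt0n cardG_gt0. Qed.

Lemma avg_idem_mull (A : {set gT}) :
  (B * A = A)%g -> avg_idem * ga_sum C A = ga_sum C A.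
Proof.
move=> BA; rewrite -scalerAl mulr_suml (eq_bigr (fun=> ga_sum C A)).
  by rewrite sumr_const -scaler_nat scalerA mulVf // scale1r.
move=> x Bx; rewrite ga_eltM_sum; congr ga_sum.
by rewrite -{1}BA mulgA lcoset_id.
Qed.

Lemma avg_idem_mulr (A : {set gT}) :
  (A * B = A)%g -> ga_sum C A * avg_idem = ga_sum C A.
Proof.
move=> AB; rewrite -scalerAr mulr_sumr (eq_bigr (fun=> ga_sum C A)).
  by rewrite sumr_const -scaler_nat scalerA mulVf // scale1r.
move=> x Bx; rewrite ga_sumM_elt; congr ga_sum.
by rewrite -{1}AB -mulgA rcoset_id.
Qed.

Lemma avg_idemM : avg_idem * avg_idem = avg_idem.
Proof. by rewrite {2}/avg_idem -scalerAr avg_idem_mull ?mulGid. Qed.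

Lemma avg_idem_neq0 : avg_idem != 0.
Proof.
rewrite scaler_eq0 invr_eq0 (negPf cardB_neq0) /=.
apply/eqP=> /ffunP/(_ 1%g); rewrite sum_ffunE (bigD1 1%g) //= !ffunE eqxx.
rewrite big1 ?addr0; first by apply/eqP/oner_neq0.
by move=> y /andP[_ /negPf nt_y]; rewrite ffunE eq_sym nt_y.
Qed.

(* The corner e C[G] e of the group algebra, as the image of v |-> e * v * e.  *)
Definition hecke_space : {vspace CG} :=
  limg (amulr avg_idem \o amull avg_idem)%VF.

Lemma hecke_spaceP (u : CG) :
  reflect (exists v, u = avg_idem * v * avg_idem) (u \in hecke_space).
Proof.
apply: (iffP memv_imgP) => [[v _ ->]|[v ->]]; exists v; rewrite ?memvf //.
  by rewrite comp_lfunE !lfunE.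
by rewrite comp_lfunE !lfunE.
Qed.

Lemma hecke_space_id (u : CG) :
  u \in hecke_space -> avg_idem * u = u /\ u * avg_idem = u.
Proof.
by case/hecke_spaceP=> v ->; rewrite !mulrA avg_idemM -!mulrA avg_idemM.
Qed.

Fact hecke_is_algid : is_algid avg_idem hecke_space.
Proof.
split; last exact: hecke_space_id; last exact: avg_idem_neq0.
by apply/hecke_spaceP; exists 1; rewrite mulr1 avg_idemM.
Qed.

Fact hecke_is_aspace : is_aspace hecke_space.
Proof.
apply/andP; split.
  by apply/has_algidP; exists avg_idem; apply: hecke_is_algid.
apply/prodvP=> u v /hecke_space_id[eu _] /hecke_space_id[_ ve].
by apply/hecke_spaceP; exists (u * v); rewrite mulrA eu -mulrA ve.
Qed.

Definition hecke_aspace : {aspace CG} := ASpace hecke_is_aspace.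

(* The inherited unit of this algebra is the averaging idempotent, not the     *)
(* unit of C[G]: see hecke_val1 below.                                         *)
Definition hecke_algebra : Type := subvs_of hecke_aspace.

HB.instance Definition _ :=
  Falgebra.copy hecke_algebra (subvs_of hecke_aspace).

Lemma hecke_val1 : vsval (1 : hecke_algebra) = avg_idem.
Proof.
have [eu _] := hecke_space_id (memv_algid hecke_aspace).
rewrite -[LHS]eu; apply: (algidr (A := hecke_aspace)).
by case: hecke_is_algid.
Qed.

Fact hecke_dcoset_subproof (w : gT) :
  #|B|%:R^-1 *: ga_sum C (B :* w * B)%g \in hecke_aspace.
Proof.
rewrite memvZ //; apply/hecke_spaceP; exists (ga_sum C (B :* w * B)%g).
by rewrite avg_idem_mull ?avg_idem_mulr // -?mulgA ?mulGid // !mulgA mulGid.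
Qed.

Definition hecke_dcoset (w : gT) : hecke_algebra :=
  Subvs (hecke_dcoset_subproof w).

Fact hecke_central_subproof (A : {set gT}) : (forall g, A :^ g = A)%g ->
  ga_sum C A * avg_idem \in hecke_aspace.
Proof.
move=> normA; apply/hecke_spaceP; exists (ga_sum C A).
by rewrite (ga_sum_central normA) -mulrA avg_idemM.
Qed.

(* The central element given by the sum over A, a union of conjugacy classes,  *)
(* is sent to the Hecke algebra by multiplication by its unit.                 *)
Definition hecke_central (A : {set gT}) (normA : (forall g, A :^ g = A)%g) :
  hecke_algebra := Subvs (hecke_central_subproof normA).

End HeckePair.

(* {'GL_n[F]} consists of matrices of size n.-1.+1, which is n when n > 0;     *)
(* rows, columns and permutations are therefore indexed by 'I_n.-1.+1.         *)
Section GL.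

Variables (F : finFieldType) (n : nat).

(* is_trig_mx means lower triangular. *)
Definition borel : {set {'GL_n[F]}} := [set g | is_trig_mx (GLval g)^T].

Fact borel_group_set : group_set borel.
Proof.
apply/group_setP; split=> [|g h]; rewrite !inE.
  by rewrite GL_1E trmx1 scalar_mx_is_trig.
move=> /is_trig_mxP tg /is_trig_mxP th; apply/is_trig_mxP=> i j ltij.
rewrite GL_MxE !mxE big1 // => k _.
have [ltkj|lejk] := ltnP k j.
  by have := tg k j ltkj; rewrite mxE => ->; rewrite mul0r.
by have := th i k (leq_trans ltij lejk); rewrite mxE => ->; rewrite mulr0.
Qed.

Canonical borel_group := Group borel_group_set.

Definition transvections : {set {'GL_n[F]}} :=
  [set g | [exists v : 'cV[F]_n.-1.+1, exists a : 'cV[F]_n.-1.+1,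
    [&& v != 0, a != 0, a^T *m v == 0 & GLval g == 1%:M + v *m a^T]]].

Fact transvections_conj (g : {'GL_n[F]}) :
  (transvections :^ g = transvections)%g.
Proof.
have sub h : (transvections :^ h \subset transvections)%g.
  apply/subsetP=> _ /imsetP[t + ->]; rewrite !inE.
  case/existsP=> v /existsP[a /and4P[nz_v nz_a /eqP av0 /eqP def_t]].
  have hu : GLval h \in unitmx := GL_unit h.
  apply/existsP; exists (invmx (GLval h) *m v).
  apply/existsP; exists ((GLval h)^T *m a); apply/and4P; split.
  - apply: contraNneq nz_v => /(congr1 (mulmx (GLval h))).
    by rewrite mulKVmx // mulmx0 => ->.
  - apply: contraNneq nz_a => /(congr1 (mulmx (invmx (GLval h)^T))).
    by rewrite mulKmx ?unitmx_tr // mulmx0 => ->.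
  - by rewrite trmx_mul trmxK -mulmxA mulKVmx // av0.
  rewrite conjgE !GL_MxE GL_VxE def_t trmx_mul trmxK.
  by rewrite mulmxDl mul1mx mulmxDr mulVmx // !mulmxA.
apply/eqP; rewrite eqEsubset sub /= -sub_conjgV.
exact: sub.
Qed.

Fact perm_mx_unit (s : 'S_n.-1.+1) : perm_mx s \in @unitmx F n.-1.+1.
Proof. exact: unitmx_perm. Qed.

(* perm_mx s has its ones at the entries (i, s i), so that permGL is a group   *)
(* morphism for the left-to-right product of permutations. The matrix sending  *)
(* the basis vector e_j to e_(s j) is its transpose; the two conventions agree *)
(* on involutions, in particular on transpositions.                           *)
Definition permGL (s : 'S_n.-1.+1) : {'GL_n[F]} :=
  Sub (perm_mx s) (perm_mx_unit s).

Variable C : numFieldType.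

Definition heckeGL : Type := hecke_algebra C borel_group.

HB.instance Definition _ := Falgebra.copy heckeGL (hecke_algebra C borel_group).

Lemma heckeGL_val1 : vsval (1 : heckeGL) = avg_idem C borel_group.
Proof. exact: hecke_val1. Qed.

Definition heckeT (s : 'S_n.-1.+1) : heckeGL :=
  hecke_dcoset C borel_group (permGL s).

Definition heckeD : heckeGL := hecke_central C borel_group transvections_conj.

End GL.

Arguments heckeGL : clear implicits.
Arguments heckeT F n C s : clear implicits.
Arguments heckeD F n C : clear implicits.

Definition qint (C : fieldType) (q k : nat) : C :=
  (q%:R ^+ k - 1) / (q%:R - 1).

(* Main.v *)
Require Import Defs.
From mathcomp Require Import all_boot all_order all_algebra all_fingroup.
From mathcomp Require Import falgebra reals complex zify.

Import GRing.Theory Num.Theory.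
Local Open Scope ring_scope.
Local Open Scope complex_scope.

Set Implicit Arguments.
Unset Strict Implicit.
Unset Printing Implicit Defensive.

(** Let B be the Borel subgroup and T the set of transvections. The coefficient
    of D at a matrix x is #|T :&: x B| / #|B|. As T is stable under conjugation,
    this number depends only on the double coset B x B
    ([card_lcosetI_dcoset]), so D is the combination of the T_w whose
    coefficients are the numbers #|T :&: w B|, over representatives w of the
    double cosets that meet T ([hecke_central_expand]).

    Which double cosets meet T? Write a transvection as 1 + v a^T with
    a^T v = 0, let m be the last index with v_m != 0 and l the first index with
    a_l != 0. If m <= l the matrix is upper triangular. Otherwise l < m, and row
    reduction by an explicit element of B shows that it lies in the cell of the
    transposition (l m) ([transvection_dcoset]). Cells of distinct permutations
    are disjoint ([permGL_dcoset_inj]).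

    It remains to count, for matrices of size n + 1 over a field with q
    elements. A transvection in B is determined by m and by a single vector:
    normalise v_m = 1; then v is free before m, and a is supported strictly
    after m and nonzero. This gives q^m (q^(n-m) - 1) = q^n - q^m possibilities
    for each m, and the sum over m is n q^n - [n]_q
    ([card_transvections_borel]). A transvection in (l m) B normalises to
    v = (u', 1, 0, t, 0) and a = (0, -1, 0, 1/t, u''), where the five blocks are
    the indices before l, l itself, those between l and m, m itself, and those
    after m. With t != 0 and n - (m - l) free entries there are
    (q - 1) q^(n - (m - l)) of them ([card_transvections_cell]). *)

(** * Conjugation-invariant sums in the Hecke algebra of a pair *)

Section CentralElement.

Variables (C : numFieldType) (gT : finGroupType) (B : {group gT}).

Lemma ga_sumE (A : {set gT}) x : ga_sum C A x = (x \in A)%:R.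
Proof.
rewrite /ga_sum sum_ffunE; under eq_bigr do rewrite ffunE.
have [Ax|nAx] := boolP (x \in A).
  by rewrite (bigD1 x) //= eqxx big1 ?addr0 // => y /andP[_ /negPf]; rewrite eq_sym => ->.
by rewrite big1 // => y Ay; case: eqP => // xy; rewrite xy Ay in nAx.
Qed.

Lemma ga_sum_avgE (A : {set gT}) x :
  (ga_sum C A * avg_idem C B) x = #|B|%:R^-1 * #|A :&: (x *: B)%g|%:R.
Proof.
rewrite -scalerAr ffunE /GRing.scale /=; congr (_ * _).
rewrite ffunE -sum1_card natr_sum [RHS]big_mkcond /=.
apply: eq_bigr => y _; rewrite !ga_sumE inE mem_lcoset -natrM mulnb.
by rewrite -groupV invMg invgK; case: (_ && _).
Qed.

Lemma dcosetP (w x : gT) :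
  reflect (exists b c, [/\ b \in B, c \in B & x = b * w * c]%g)
          (x \in (B :* w * B)%g).
Proof.
apply: (iffP mulsgP) => [[_ c /rcosetP[b Bb ->] Bc ->]|[b [c [Bb Bc ->]]]].
  by exists b, c.
by exists (b * w)%g c => //; apply/rcosetP; exists b.
Qed.

Lemma dcoset_trans (w x y : gT) :
  x \in (B :* w * B)%g -> y \in (B :* x * B)%g -> y \in (B :* w * B)%g.
Proof.
move=> /dcosetP[b [c [Bb Bc ->]]] /dcosetP[b' [c' [Bb' Bc' ->]]].
by apply/dcosetP; exists (b' * b)%g, (c * c')%g; rewrite !groupM // !mulgA.
Qed.

Lemma dcoset_sym (x y : gT) :
  x \in (B :* y * B)%g -> y \in (B :* x * B)%g.
Proof.
move=> /dcosetP[b [c [Bb Bc ->]]]; apply/dcosetP; exists b^-1%g, c^-1%g.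
by rewrite !groupV -!mulgA mulgV mulg1 mulKg.
Qed.

Lemma mem_dcoset_subgroup (w x : gT) :
  x \in (B :* w * B)%g -> (x \in B) = (w \in B).
Proof. by move=> /dcosetP[b [c [Bb Bc ->]]]; rewrite groupMr // groupMl. Qed.

(** Conjugation by b carries w B to b w B, because B absorbs b on the right. *)
Lemma card_lcosetI_dcoset (A : {set gT}) (w x : gT) :
  (forall g, A :^ g = A)%g -> x \in (B :* w * B)%g ->
  #|A :&: (x *: B)%g| = #|A :&: (w *: B)%g|.
Proof.
move=> normA /dcosetP[b [c [Bb Bc ->]]].
rewrite -(cardJg _ b) conjIg normA; apply: eq_card => y; rewrite !inE; congr (_ && _).
rewrite mem_conjg !mem_lcoset conjgE !invMg !invgK -!mulgA groupMl ?groupV //.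
by rewrite mulKg !mulgA groupMr ?groupV.
Qed.

(** Reading a Hecke element as a function with values in C itself keeps the
    coefficient identities free of the module structures on functions. *)
Definition hecke_coef (x : gT) (u : hecke_algebra C B) : C := vsval u x.

Lemma hecke_coef_inj (u v : hecke_algebra C B) :
  (forall x, hecke_coef x u = hecke_coef x v) -> u = v.
Proof. by move=> eq_uv; apply: val_inj; apply/ffunP. Qed.

Lemma hecke_coefD x u v : hecke_coef x (u + v) = hecke_coef x u + hecke_coef x v.
Proof. by rewrite /hecke_coef linearD ffunE. Qed.

Lemma hecke_coefZ x k u : hecke_coef x (k *: u) = k * hecke_coef x u.
Proof. by rewrite /hecke_coef linearZ ffunE. Qed.

Lemma hecke_coef_sum x I (r : seq I) (P : pred I) (u : I -> hecke_algebra C B) :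
  hecke_coef x (\sum_(i <- r | P i) u i) = \sum_(i <- r | P i) hecke_coef x (u i).
Proof.
by apply: (big_morph _ (hecke_coefD x)); rewrite /hecke_coef linear0 ffunE.
Qed.

Lemma hecke_coef_dcoset x w :
  hecke_coef x (hecke_dcoset C B w) = #|B|%:R^-1 * (x \in (B :* w * B)%g)%:R.
Proof. by rewrite /hecke_coef /= ffunE ga_sumE. Qed.

Lemma hecke_coef1 x : hecke_coef x 1 = #|B|%:R^-1 * (x \in B)%:R.
Proof. by rewrite /hecke_coef hecke_val1 ffunE ga_sumE. Qed.

(** Both sides are functions constant on the double cosets; at x the left one is
    #|A :&: x B| / #|B|, which vanishes outside the double cosets meeting A. The
    trivial double coset is kept apart since its basis element is the unit. *)
Lemma hecke_central_expand (A : {set gT}) (normA : (forall g, A :^ g = A)%g)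
    (I : finType) (P : pred I) (w : I -> gT) :
    (forall i, P i -> w i \notin B) ->
    (forall i j, P i -> P j -> w i \in (B :* w j * B)%g -> i = j) ->
    (forall g, g \in A -> g \notin B -> exists2 i, P i & g \in (B :* w i * B)%g) ->
  hecke_central C B normA = #|A :&: B|%:R%:A
    + \sum_(i | P i) #|A :&: (w i *: B)%g|%:R *: hecke_dcoset C B (w i).
Proof.
move=> wNB wI cover; apply: hecke_coef_inj => x.
rewrite [LHS]ga_sum_avgE hecke_coefD hecke_coefZ hecke_coef1 hecke_coef_sum.
under eq_bigr do rewrite hecke_coefZ hecke_coef_dcoset.
have [Bx|nBx] := boolP (x \in B).
  rewrite big1 => [|i Pi].
    by rewrite mulr1 addr0 mulrC lcoset_id.
  case: (boolP (x \in _)) => [xi|_]; last by rewrite !mulr0.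
  by have := wNB i Pi; rewrite -(mem_dcoset_subgroup xi) Bx.
rewrite !mulr0 add0r.
case: (pickP [pred i | P i && (x \in (B :* w i * B)%g)]) => [i /andP[Pi xi]|no].
  rewrite (bigD1 i) //= xi mulr1 big1 ?addr0 => [|j /andP[Pj nji]].
    by rewrite (card_lcosetI_dcoset normA xi) mulrC.
  case: (boolP (x \in _)) => [xj|_]; last by rewrite !mulr0.
  case/eqP: nji; apply: wI => //.
  exact: dcoset_trans xi (dcoset_sym xj).
rewrite big1 => [|i Pi]; last by move: (no i); rewrite /= Pi => /= ->; rewrite !mulr0.
suff ->: A :&: (x *: B)%g = set0 by rewrite cards0 mulr0.
apply/setP=> y; rewrite !inE; apply/negP=> /andP[Ay].
move=> xBy; have xy : x \in (B :* y * B)%g.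
  apply/dcosetP; exists 1%g, (y^-1 * x)%g; rewrite mul1g mulKVg group1.
  by rewrite -groupV invMg invgK -mem_lcoset.
have nBy : y \notin B by rewrite -(mem_dcoset_subgroup xy).
have [i Pi yi] := cover y Ay nBy.
by have /negP[] := no i; rewrite /= Pi; apply: dcoset_trans xy.
Qed.

End CentralElement.

(** * Disjointness of the Bruhat cells *)

Section BruhatCells.

Variables (F : finFieldType) (n : nat).
Local Notation GL := {'GL_n.+1[F]}.
Local Notation B := (borel_group F n.+1).
Local Notation permG := (@permGL F n.+1).
Implicit Types (g b : GL) (s t : 'S_n.+1) (v a : 'cV[F]_n.+1).

Lemma borelP g :
  reflect (forall i j : 'I_n.+1, (j < i)%N -> GLval g i j = 0) (g \in B).
Proof.
rewrite inE; apply: (iffP is_trig_mxP) => trig i j ltji.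
  by have:= trig _ _ ltji; rewrite mxE.
by rewrite mxE trig.
Qed.

Lemma borel_diag_neq0 g i : g \in B -> GLval g i i != 0.
Proof.
rewrite inE => /det_trig; rewrite det_tr => det_g.
have: \det (GLval g) != 0 by rewrite -unitfE -unitmxE GL_unit.
by rewrite det_g => /prodf_neq0/(_ i isT); rewrite mxE.
Qed.

Lemma borel_of_triangular (M : 'M[F]_n.+1) :
    (forall i j : 'I_n.+1, (j < i)%N -> M i j = 0) -> (forall i, M i i != 0) ->
  exists2 g : GL, g \in B & GLval g = M.
Proof.
move=> trigM diagM.
have uM : M \in unitmx.
  have trM: is_trig_mx M^T by apply/is_trig_mxP => i j /trigM; rewrite mxE.
  rewrite unitmxE -det_tr (det_trig trM) unitfE; apply/prodf_neq0 => i _.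
  by rewrite mxE.
by exists (Sub M uM) => //; apply/borelP.
Qed.

Lemma permGL_mulE s g i j : GLval (permG s * g)%g i j = GLval g (s i) j.
Proof. by rewrite GL_MxE -row_permE mxE. Qed.

Lemma mulGL_permE s g i j : GLval (g * permG s)%g i j = GLval g i (s^-1%g j).
Proof.
by rewrite GL_MxE -[GLval (permG s)]/(perm_mx s) -{1}[s]invgK -col_permE mxE.
Qed.

Lemma permGLV s : (permG s)^-1%g = permG s^-1%g.
Proof.
apply: (mulgI (permG s)); rewrite mulgV; apply/esym/val_inj.
by rewrite [LHS]GL_MxE -perm_mxM mulgV perm_mx1.
Qed.

(** The values of a permutation have the same sum as the indices, so none of the
    inequalities can be strict. *)
Lemma le_perm_id s : (forall i : 'I_n.+1, (i <= s i)%N) -> s = 1%g.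
Proof.
move=> le_s; pose eqs i := i == s i.
have /leqif_sum: forall i : 'I_n.+1, true -> (i <= s i ?= iff eqs i)%N.
  by move=> i _; split; [exact: le_s | exact: val_eqE].
move=> le_sum; apply/permP=> i; rewrite perm1; apply/esym/eqP.
suff /forallP/(_ i): [forall (i | true), eqs i] by [].
by rewrite -(eq_leqif le_sum); apply/eqP; rewrite [LHS](reindex_inj (@perm_inj _ s)).
Qed.

(** If b s = t c with b and c upper triangular, a nonzero diagonal entry of one
    side sits at an entry of the other that must be on or above the diagonal:
    this bounds i by the image of i under s t^-1. *)
Lemma permGL_dcoset_inj s t : permG s \in (B :* permG t * B)%g -> s = t.
Proof.
case/dcosetP=> b [c [Bb Bc def_s]].
have eq_sc : (permG s * c^-1 = b * permG t)%g by rewrite def_s mulgK.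
apply/eqP; rewrite eq_mulgV1; apply/eqP/le_perm_id => i.
have := borel_diag_neq0 (s i) (groupVr Bc).
rewrite -permGL_mulE eq_sc mulGL_permE permM leqNgt.
by apply: contraNN => /(borelP b Bb)->.
Qed.

Lemma permGL_borel s : permG s \in B -> s = 1%g.
Proof.
move=> Bs; apply: permGL_dcoset_inj; apply/dcosetP; exists (permG s), 1%g.
split=> //; suff -> : permG 1 = 1%g by rewrite !mulg1.
by apply: val_inj; rewrite /= perm_mx1.
Qed.

Lemma mem_perm_lcoset s g :
  reflect (forall i j : 'I_n.+1, (j < s i)%N -> GLval g i j = 0)
          (g \in (permG s *: B)%g).
Proof.
rewrite mem_lcoset permGLV; apply: (iffP (borelP _)) => H i j.
  by move=> /H; rewrite permGL_mulE permK.
by rewrite permGL_mulE => ltji; apply: H; rewrite permKV.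
Qed.

End BruhatCells.

(** * The Bruhat cells met by transvections *)

Section Transvections.

Variables (F : finFieldType) (n : nat).
Local Notation GL := {'GL_n.+1[F]}.
Local Notation B := (borel_group F n.+1).
Local Notation permG := (@permGL F n.+1).
Local Notation T := (transvections F n.+1).
Implicit Types (g b : GL) (v a : 'cV[F]_n.+1) (i j k l m : 'I_n.+1).

Lemma rank1E v a i j : (1%:M + v *m a^T) i j = (i == j)%:R + v i 0 * a j 0.
Proof. by rewrite !mxE big_ord1 !mxE. Qed.

Lemma dot_eq0 v a : (a^T *m v == 0) = (\sum_j a j 0 * v j 0 == 0).
Proof.
have dotE : (a^T *m v) 0 0 = \sum_j a j 0 * v j 0.
  by rewrite mxE; under eq_bigr do rewrite mxE.
rewrite -dotE; apply/eqP/eqP=> [->|av0]; first by rewrite mxE.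
by apply/matrixP=> i j; rewrite !ord1 av0 mxE.
Qed.

Lemma transvectionsP g :
  reflect (exists v a, [/\ v != 0, a != 0, a^T *m v = 0 & GLval g = 1%:M + v *m a^T])
          (g \in T).
Proof.
rewrite inE; apply: (iffP existsP) => [[v /existsP[a /and4P[? ? /eqP ? /eqP ?]]]|].
  by exists v, a.
by case=> v [a [? ? /eqP ? /eqP ?]]; exists v; apply/existsP; exists a; apply/and4P.
Qed.

(** The default value 1 is only taken when a^T v = -1. *)
Definition transv v a : GL := insubd (1%g : GL) (1%:M + v *m a^T).

Lemma transvE v a : a^T *m v = 0 -> GLval (transv v a) = 1%:M + v *m a^T.
Proof.
move=> av0; apply: insubdK.
(* the inverse of 1 + v a^T is 1 - v a^T *)
have /mulmx1_unit[] // : (1%:M + v *m a^T) *m (1%:M - v *m a^T) = 1%:M.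
rewrite mulmxDl mul1mx mulmxBr mulmx1 mulmxA -(mulmxA v) av0 mulmx0 mul0mx.
by rewrite subr0 subrK.
Qed.

Lemma exists_last_support v : v != 0 ->
  exists2 m, v m 0 != 0 & forall k, (m < k)%N -> v k 0 = 0.
Proof.
case/cV0Pn=> k0 vk0; case: (@arg_maxnP _ k0 (fun k => v k 0 != 0) val vk0) => m vm max_m.
by exists m => // k; apply: contraTeq => /max_m; rewrite -leqNgt.
Qed.

Lemma exists_first_support a : a != 0 ->
  exists2 l, a l 0 != 0 & forall k, (k < l)%N -> a k 0 = 0.
Proof.
case/cV0Pn=> k0 ak0; case: (@arg_minnP _ k0 (fun k => a k 0 != 0) val ak0) => l al min_l.
by exists l => // k; apply: contraTeq => /min_l; rewrite -leqNgt.
Qed.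

(** Left multiplication by an upper triangular b can bring the rows l and m of g
    to rows starting at m and at l, and every other row k to one starting at k,
    so that exchanging the rows l and m of b g gives an upper triangular
    matrix. *)
Lemma transvection_dcoset g v a l m :
    GLval g = 1%:M + v *m a^T -> a^T *m v = 0 -> (l < m)%N ->
    v m 0 != 0 -> (forall k, (m < k)%N -> v k 0 = 0) ->
    a l 0 != 0 -> (forall k, (k < l)%N -> a k 0 = 0) ->
  g \in (B :* permG (tperm l m) * B)%g.
Proof.
move=> gE av0 ltlm vm v0 al a0.
have nlm: (l == m) = false by apply/negbTE; rewrite neq_ltn ltlm.
(* Row k of b g is b_k + (b_k v) a^T. The row b_l = e_m - v_m a^T starts at l and
   yields b_l g = e_m; the row b_m = e_m yields b_m g = e_m + v_m a^T, which
   starts at l; each row other than l and m has b_k v = 0, so that g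
   leaves it unchanged. *)
pose r k : 'rV[F]_n.+1 :=
  if k == l then delta_mx 0 m - v m 0 *: a^T
  else if k == m then delta_mx 0 m
  else delta_mx 0 k - (v k 0 / v m 0) *: delta_mx 0 m.
pose M := \matrix_k r k.
have ME k j : M k j =
    if k == l then (j == m)%:R - v m 0 * a j 0
    else if k == m then (j == m)%:R
    else (j == k)%:R - (v k 0 / v m 0) * (j == m)%:R.
  by rewrite mxE /r; case: (k == l); [|case: (k == m)]; rewrite !mxE eqxx.
have rv k : (M *m v) k 0 = if (k == l) || (k == m) then v m 0 else 0.
  have -> : (M *m v) k 0 = (r k *m v) 0 0.
    by rewrite !mxE; apply: eq_bigr => j _; rewrite mxE.
  have dv j : ((delta_mx 0 j : 'rV_n.+1) *m v) 0 0 = v j 0 by rewrite -rowE mxE.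
  rewrite /r; case: (k == l) => /=; last case: (k == m) => //=.
  - by rewrite mulmxBl -scalemxAl av0 scaler0 subr0 dv.
  - by rewrite mulmxBl -scalemxAl mxE dv 2!mxE dv divfK ?subrr.
have [b Bb bE] : exists2 b, b \in B & GLval b = M.
  apply: borel_of_triangular => [i j ltji|i]; rewrite ME.
    have [il|nil] := eqVneq i l.
      rewrite {}il in ltji; rewrite a0 // mulr0 subr0 -val_eqE.
      by rewrite ltn_eqF // (ltn_trans ltji).
    have [im|nim] := eqVneq i m; first by rewrite -im -val_eqE ltn_eqF.
    rewrite -!val_eqE (ltn_eqF ltji) sub0r.
    have [jm|_] := eqVneq; last by rewrite mulr0 oppr0.
    by rewrite v0 ?mul0r ?oppr0 // -jm.
  have [->|nil] := eqVneq i l; first by rewrite nlm sub0r oppr_eq0 mulf_neq0.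
  have [_|nim] := eqVneq i m; first by rewrite oner_eq0.
  by rewrite eqxx mulr0 subr0 oner_eq0.
have bgE k j : GLval (b * g)%g k j = M k j + (M *m v) k 0 * a j 0.
  by rewrite GL_MxE bE gE mulmxDr mulmx1 mulmxA !mxE big_ord1 !mxE.
apply/dcosetP; exists b^-1%g, (permG (tperm l m) * (b * g))%g; split.
- by rewrite groupV.
- apply/borelP => i j ltji; rewrite permGL_mulE bgE ME rv.
  case: tpermP ltji => [->|->|nil nim] ltji; rewrite ?eqxx ?nlm ?orbT ?orTb.
  + by rewrite (eq_sym m) nlm a0 // mulr0 addr0 -val_eqE ltn_eqF // (ltn_trans ltji).
  + by rewrite subrK -val_eqE ltn_eqF.
  + have /negPf-> : i != l by apply/eqP.
    have /negPf-> : i != m by apply/eqP.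
    rewrite /= mul0r addr0 -!val_eqE (ltn_eqF ltji) sub0r.
    have [jm|_] := eqVneq; last by rewrite mulr0 oppr0.
    by rewrite v0 ?mul0r ?oppr0 // -jm.
have PP : (permG (tperm l m) * permG (tperm l m) = 1)%g.
  by rewrite -{1}[permG _]invgK permGLV tpermV mulVg.
by rewrite -mulgA (mulgA (permG _)) PP mul1g mulKg.
Qed.

Lemma transvection_cover g : g \in T -> g \notin B ->
  exists2 p : 'I_n.+1 * 'I_n.+1, (p.1 < p.2)%N
    & g \in (B :* permG (tperm p.1 p.2) * B)%g.
Proof.
case/transvectionsP=> v [a [nzv nza av0 gE]].
have [m vm v0] := exists_last_support nzv.
have [l al a0] := exists_first_support nza.
have [ltlm _|leml] := ltnP l m.
  by exists (l, m) => //; apply: transvection_dcoset gE av0 ltlm vm v0 al a0.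
case/borelP => i j ltji; rewrite gE rank1E -val_eqE (gtn_eqF ltji) add0r.
have [/v0->|leim] := ltnP m i; first by rewrite mul0r.
by rewrite a0 ?mulr0 // (leq_trans ltji) // (leq_trans leim).
Qed.

End Transvections.

(** * Counting transvections in a coset of the Borel subgroup *)

Section Counting.

Variables (F : finFieldType) (n : nat).
Local Notation GL := {'GL_n.+1[F]}.
Local Notation B := (borel_group F n.+1).
Local Notation permG := (@permGL F n.+1).
Local Notation T := (transvections F n.+1).
Local Notation q := #|F|.
Implicit Types (g : GL) (v a : 'cV[F]_n.+1) (i j k l m : 'I_n.+1).
Implicit Types (D : pred 'I_n.+1) (u : {ffun 'I_n.+1 -> F}).

Definition supported D : {set {ffun 'I_n.+1 -> F}} := [set u in pffun_on 0 D predT].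

Lemma supportedP D u : reflect (forall k, ~~ D k -> u k = 0) (u \in supported D).
Proof.
rewrite inE; apply: (iffP pffun_onP) => [[/supportP sDu _] k /sDu //|Du].
by split=> //; apply/supportP => k /Du.
Qed.

Lemma card_supported D : #|supported D| = (q ^ #|D|)%N.
Proof. by rewrite cardsE card_pffun_on. Qed.

Lemma card_ord_lt (m : nat) : (m <= n.+1)%N -> #|[pred k : 'I_n.+1 | (k < m)%N]| = m.
Proof.
move=> lemn; rewrite -sum1_card (eq_bigl (fun k : 'I_n.+1 => (k < m)%N)) //.
by rewrite -(big_ord_widen _ (fun=> 1%N) lemn) sum1_card card_ord.
Qed.

Lemma card_ord_outside l m : (l < m)%N ->
  #|[pred k : 'I_n.+1 | (k < l)%N || (m < k)%N]| = (n - (m - l))%N.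
Proof.
move=> ltlm; set out := [pred k : 'I_n.+1 | _].
have cardCout : (l + #|[predC out]| = m.+1)%N.
  rewrite -[RHS](card_ord_lt (ltn_ord m)) -[RHS](cardID [pred k : 'I_n.+1 | (k < l)%N]).
  congr (_ + _)%N; last first.
    by apply: eq_card => k; rewrite !inE negb_or -!leqNgt ltnS.
  rewrite -[LHS](card_ord_lt (ltnW (ltn_ord l))); apply: eq_card => k.
  by rewrite !inE andb_idl // => ltkl; rewrite ltnS ltnW // (ltn_trans ltkl).
have cardCn : (#|out| + #|[predC out]| = n.+1)%N by rewrite cardC card_ord.
move: cardCout cardCn (ltn_ord m); move: #|out| #|[predC out]| => x y; lia.
Qed.

(** The normalised column v and row a of an upper triangular transvection use the
    entries of a single vector u, v those before m and a those after m. *)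
Definition borel_col m u : 'cV[F]_n.+1 := \col_k (if (k < m)%N then u k else (k == m)%:R).
Definition borel_row m u : 'cV[F]_n.+1 := \col_k (if (m < k)%N then u k else 0).

(** The vector u vanishes at m, to make the parameters unique, and not
    everywhere after m, as a != 0: the vectors supported off m, less those
    supported before m. *)
Lemma card_transvections_borel : #|T :&: B| = (\sum_(m < n.+1) (q ^ n - q ^ m))%N.
Proof.
pose Q m u := u \in supported (predC1 m) :\: supported [pred k : 'I_n.+1 | (k < m)%N].
pose f (p : 'I_n.+1 * {ffun 'I_n.+1 -> F}) := transv (borel_col p.1 p.2) (borel_row p.1 p.2).
have dot0 m u : (borel_row m u)^T *m borel_col m u = 0.
  apply/eqP; rewrite dot_eq0 big1 // => k _; rewrite !mxE -val_eqE.
  by case: ltngtP; rewrite ?mulr0 ?mul0r.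
have fE m u i j : GLval (f (m, u)) i j = (i == j)%:R + borel_col m u i 0 * borel_row m u j 0.
  by rewrite /f transvE // rank1E.
have up_neq0 m u : Q m u -> exists2 j : 'I_n.+1, (m < j)%N & u j != 0.
  rewrite /Q inE => /andP[nQ /supportedP Qu]; apply/exists_inP; apply: contraNT nQ.
  move=> /exists_inPn nj; apply/supportedP => k; rewrite -leqNgt leq_eqVlt.
  case/orP=> [/eqP/val_inj<-|/nj]; first by apply: Qu; rewrite /= negbK.
  by rewrite negbK => /eqP.
rewrite (_ : T :&: B = f @: [set p | Q p.1 p.2]); last first.
  apply/setP=> g; apply/setIP/imsetP => [[/transvectionsP[v [a [nzv nza av0 gE]]] /borelP Bg]|].
    have [m vm v0] := exists_last_support nzv.
    have a_lt k : (k < m)%N -> a k 0 = 0.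
      move=> ltkm; have := Bg m k ltkm; rewrite gE rank1E -val_eqE gtn_eqF // add0r.
      by move/eqP; rewrite mulf_eq0 (negPf vm) => /eqP.
    (* every other term of a^T v vanishes *)
    have a_m : a m 0 = 0.
      move/eqP: av0; rewrite dot_eq0 (bigD1 m) //= big1 ?addr0 => [|k].
        by rewrite mulf_eq0 (negPf vm) orbF => /eqP.
      by rewrite neq_ltn => /orP[/a_lt->|/v0->]; rewrite ?mul0r ?mulr0.
    pose u := [ffun k : 'I_n.+1 => if (k < m)%N then v k 0 / v m 0
                         else if (m < k)%N then v m 0 * a k 0 else 0].
    exists (m, u).
      rewrite inE /Q inE; apply/andP; split.
        have [l al _] := exists_first_support nza.
        have ltml : (m < l)%N.
          by rewrite ltnNge leq_eqVlt; apply: contra al => /orP[/eqP/val_inj->|/a_lt->];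
            rewrite ?a_m.
        apply/negP=> /supportedP/(_ l); rewrite /= -leqNgt ltnW // => /(_ isT)/eqP.
        by rewrite ffunE ltnNge ltnW //= ltml mulf_eq0 (negPf vm) (negPf al).
      by apply/supportedP => k /=; rewrite negbK => /eqP->; rewrite ffunE ltnn.
    apply/val_inj/matrixP => i j; rewrite [LHS](congr1 (fun M : 'M_n.+1 => M i j) gE).
    rewrite [RHS]fE rank1E; congr (_ + _); rewrite !mxE !ffunE.
    have [ltjm|lemj] := ltnP j m.
      by rewrite a_lt // [(m < j)%N]ltnNge (ltnW ltjm) /= !mulr0.
    have [ltmj|lejm] := ltnP m j; last first.
      by rewrite (_ : j = m) ?a_m ?mulr0 //; apply/val_inj/eqP; rewrite eqn_leq lejm lemj.
    have [ltim|ltmi|/val_inj->] := ltngtP i m.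
    - by rewrite mulrA divfK.
    - by rewrite v0 // -val_eqE gtn_eqF // !mul0r.
    - by rewrite eqxx mul1r.
  case=> -[m u]; rewrite inE /= => Qmu ->; have [j ltmj uj] := up_neq0 m u Qmu; split.
    apply/transvectionsP; exists (borel_col m u), (borel_row m u); split=> //.
    - by apply/cV0Pn; exists m; rewrite mxE ltnn eqxx oner_eq0.
    - by apply/cV0Pn; exists j; rewrite mxE ltmj.
    - by rewrite /f transvE.
  apply/borelP => i k ltki; rewrite fE -val_eqE gtn_eqF // add0r !mxE.
  have [ltmk|_] := ltnP m k; last by rewrite mulr0.
  by rewrite -val_eqE ltnNge ltnW ?gtn_eqF ?mul0r // (ltn_trans ltmk).
rewrite card_in_imset => [|[m u] [m' u']]; last first.
  rewrite !inE /= => Qmu Qmu' eq_f.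
  have E i j : borel_col m u i 0 * borel_row m u j 0
             = borel_col m' u' i 0 * borel_row m' u' j 0.
    by apply: (addrI ((i == j)%:R)); rewrite -!fE eq_f.
  (* m is the last nonzero row of v a^T, so the matrix determines it *)
  have le_top k (x : {ffun 'I_n.+1 -> F}) l y :
      Q k x -> (forall i j, borel_col k x i 0 * borel_row k x j 0
      = borel_col l y i 0 * borel_row l y j 0) -> (k <= l)%N.
    move=> /up_neq0[j ltkj xj] /(_ k j); rewrite leqNgt !mxE ltnn eqxx mul1r ltkj => def_xj.
    apply: contraNN xj => ltlk.
    by rewrite def_xj -val_eqE ltnNge ltnW // gtn_eqF // mul0r.
  have eqm : m = m'.
    by apply/val_inj/eqP; rewrite eqn_leq !(le_top m u m' u', le_top m' u' m u).
  move: Qmu' E; rewrite -{m' eq_f}eqm => Qmu' E; congr (_, _).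
  have [j ltmj uj] := up_neq0 _ _ Qmu.
  have E_gt k : (m < k)%N -> u k = u' k.
    by move=> ltmk; have := E m k; rewrite !mxE ltnn eqxx ltmk !mul1r.
  apply/ffunP=> k; have [ltkm|/E_gt //|/val_inj->] := ltngtP k m.
    have := E k j; rewrite !mxE ltkm ltmj -(E_gt j ltmj).
    by move/(mulIf uj).
  move: Qmu Qmu'; rewrite /Q !in_setD => /andP[_ /supportedP/(_ m)] + /andP[_ /supportedP/(_ m)].
  by rewrite /= eqxx => -> // ->.
rewrite -sum1_card (eq_bigl (fun p => true && Q p.1 p.2)) => [|p]; last by rewrite inE.
rewrite -(pair_big_dep predT Q (fun _ _ => 1%N)) /=; apply: eq_bigr => m _.
rewrite sum1_card cardsDS ?card_supported.
  by rewrite cardC1 card_ord card_ord_lt // ltnW.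
apply/subsetP=> u /supportedP Hu; apply/supportedP=> k; rewrite /= negbK => /eqP->.
by apply: Hu; rewrite /= ltnn.
Qed.

(** In v = (u', 1, 0, t, 0) and a = (0, -1, 0, 1/t, u'') the free parts u' and u''
    are the entries before l and after m of a single vector u. *)
Definition cell_col l m (t : F) u : 'cV[F]_n.+1 :=
  \col_k (if (k < l)%N then u k else if k == l then 1 else if k == m then t else 0).
Definition cell_row l m (t : F) u : 'cV[F]_n.+1 :=
  \col_k (if (m < k)%N then u k else if k == m then t^-1 else if k == l then - 1 else 0).

(** Being in (l m) B says that row l starts at or after m, row m at or after l,
    and every other row k at or after k. Row l forces v_l a_l = -1 and a_j = 0
    for the other j < m; the rows i > l with i != m force v_i = 0; then
    a^T v = 0 forces v_m a_m = 1. *)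
Lemma card_transvections_cell l m : (l < m)%N ->
  #|T :&: (permG (tperm l m) *: B)%g| = (q.-1 * q ^ (n - (m - l)))%N.
Proof.
move=> ltlm; pose out := [pred k : 'I_n.+1 | (k < l)%N || (m < k)%N].
pose f (p : F * {ffun 'I_n.+1 -> F}) := transv (cell_col l m p.1 p.2) (cell_row l m p.1 p.2).
have neql : (l == m) = false by rewrite -val_eqE ltn_eqF.
have neqm : (m == l) = false by rewrite eq_sym.
have leml : (m < l)%N = false by apply/negbTE; rewrite -leqNgt ltnW.
have col_l t u : cell_col l m t u l 0 = 1 by rewrite mxE ltnn eqxx.
have col_m t u : cell_col l m t u m 0 = t by rewrite mxE leml neqm eqxx.
have col_lt t u k : (k < l)%N -> cell_col l m t u k 0 = u k by rewrite mxE => ->.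
have col_gt t u k : (l < k)%N -> k != m -> cell_col l m t u k 0 = 0.
  by move=> ltlk /negPf nkm; rewrite mxE nkm -val_eqE gtn_eqF // ltnNge ltnW.
have row_l t u : cell_row l m t u l 0 = - 1 by rewrite mxE leml neql eqxx.
have row_m t u : cell_row l m t u m 0 = t^-1 by rewrite mxE ltnn eqxx.
have row_gt t u k : (m < k)%N -> cell_row l m t u k 0 = u k by rewrite mxE => ->.
have row_lt t u k : (k < m)%N -> k != l -> cell_row l m t u k 0 = 0.
  move=> ltkm /negPf nkl; rewrite mxE nkl -val_eqE (ltn_eqF ltkm).
  by rewrite ltnNge (ltnW ltkm).
(* outside l and m, one of the two factors of each diagonal product vanishes *)
have dot_lm v a : (forall k, k != l -> k != m -> a k 0 * v k 0 = 0) ->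
    \sum_k a k 0 * v k 0 = a l 0 * v l 0 + a m 0 * v m 0.
  move=> z; rewrite (bigD1 l) //= (bigD1 m) ?neqm //= big1 ?addr0 //.
  by move=> k /andP[]; apply: z.
have dot0 t u : t != 0 -> (cell_row l m t u)^T *m cell_col l m t u = 0.
  move=> t0; apply/eqP; rewrite dot_eq0 dot_lm => [|k nkl nkm].
    by rewrite col_l row_l col_m row_m mulr1 mulVf // addNr.
  have [ltkm|] := ltnP k m; first by rewrite row_lt ?mul0r.
  by move=> lemk; rewrite col_gt ?mulr0 // (leq_trans ltlm).
have fE t u i j : t != 0 -> GLval (f (t, u)) i j
    = (i == j)%:R + cell_col l m t u i 0 * cell_row l m t u j 0.
  by move=> t0; rewrite /f transvE ?dot0 // rank1E.
rewrite (_ : T :&: _ = f @: setX [set~ 0] (supported out)); last first.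
  apply/setP=> g; apply/setIP/imsetP => [[]|[[t u]]].
    case/transvectionsP=> v [a [_ _ /eqP av0 gE]] /mem_perm_lcoset Bg.
    have Bg_l j : (j < m)%N -> (l == j)%:R + v l 0 * a j 0 = 0.
      by move=> ltjm; rewrite -rank1E -gE Bg ?tpermL.
    have /eqP := Bg_l l ltlm; rewrite eqxx addrC addr_eq0 => /eqP vl_al.
    have /norP[vl al] : ~~ ((v l 0 == 0) || (a l 0 == 0)).
      by rewrite -mulf_eq0 vl_al oppr_eq0 oner_eq0.
    have a_lt j : (j < m)%N -> j != l -> a j 0 = 0.
      move=> /Bg_l /eqP + njl; rewrite (eq_sym l) (negPf njl) add0r mulf_eq0 (negPf vl).
      by move=> /eqP.
    have v_gt i : (l < i)%N -> i != m -> v i 0 = 0.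
      move=> ltli nim; have /eqP : GLval g i l = 0.
        by rewrite Bg // tpermD // ?(eq_sym m) // -val_eqE ltn_eqF.
      rewrite gE rank1E -val_eqE gtn_eqF // add0r mulf_eq0 (negPf al) orbF.
      by move/eqP.
    have vm_am : v m 0 * a m 0 = 1.
      move: av0; rewrite dot_eq0 dot_lm => [|k nkl nkm].
        by rewrite mulrC vl_al addrC subr_eq0 mulrC => /eqP.
      have [ltkm|lemk] := ltnP k m; first by rewrite a_lt ?mul0r.
      by rewrite v_gt ?mulr0 // (leq_trans ltlm).
    have vm : v m 0 != 0.
      by apply: contra_eq_neq vm_am => ->; rewrite mul0r eq_sym oner_eq0.
    have am : a m 0 = (v m 0)^-1 by rewrite -[RHS]mulr1 -vm_am mulKf.
    pose t := v m 0 / v l 0.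
    pose u := [ffun k : 'I_n.+1 => if (k < l)%N then v k 0 / v l 0
                         else if (m < k)%N then v l 0 * a k 0 else 0].
    have t0 : t != 0 by rewrite mulf_neq0 ?invr_eq0.
    have colE i : cell_col l m t u i 0 = v i 0 / v l 0.
      have [ltil|ltli|/val_inj->] := ltngtP i l; last by rewrite col_l divff.
        by rewrite col_lt // ffunE ltil.
      have [->|nim] := eqVneq i m; first by rewrite col_m.
      by rewrite col_gt // v_gt ?mul0r.
    have rowE j : cell_row l m t u j 0 = v l 0 * a j 0.
      have [ltjm|ltmj|/val_inj->] := ltngtP j m.
      - have [->|njl] := eqVneq j l; first by rewrite row_l vl_al.
        by rewrite row_lt // a_lt // mulr0.
      - by rewrite row_gt // ffunE ltmj ltnNge (ltnW (ltn_trans ltlm ltmj)).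
      - by rewrite row_m am invf_div.
    exists (t, u).
      rewrite inE /= inE in_set1 t0; apply/supportedP => k; rewrite /= negb_or -!leqNgt.
      by rewrite ffunE !ltnNge => /andP[-> ->].
    apply/val_inj/matrixP => i j; rewrite [LHS](congr1 (fun M : 'M_n.+1 => M i j) gE).
    by rewrite [RHS]fE // rank1E colE rowE mulrA divfK.
  rewrite inE /= inE in_set1 => /andP[t0 /supportedP Du] ->; split.
    apply/transvectionsP; exists (cell_col l m t u), (cell_row l m t u); split=> //.
    - by apply/cV0Pn; exists l; rewrite col_l oner_eq0.
    - by apply/cV0Pn; exists l; rewrite row_l oppr_eq0 oner_eq0.
    - exact: dot0.
    - by rewrite /f transvE ?dot0.
  apply/mem_perm_lcoset => i j; rewrite fE //; case: tpermP => [->|->|/eqP nil /eqP nim] ltj.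
  - rewrite col_l mul1r; have [<-|njl] := eqVneq; first by rewrite row_l subrr.
    by rewrite row_lt ?addr0 // eq_sym.
  - rewrite row_lt ?mulr0 ?addr0; last by rewrite -val_eqE ltn_eqF.
      by rewrite -val_eqE gtn_eqF // (ltn_trans ltj).
    exact: ltn_trans ltlm.
  rewrite -val_eqE (gtn_eqF ltj) add0r.
  have [ltil|ltli|/val_inj il] := ltngtP i l; last by rewrite il eqxx in nil.
    have ltjl := ltn_trans ltj ltil.
    by rewrite row_lt ?mulr0 ?(ltn_trans ltjl) // -val_eqE ltn_eqF.
  by rewrite col_gt ?mul0r.
rewrite card_in_imset => [|[t u] [t' u']]; last first.
  rewrite !in_setX /= !in_setC1 => /andP[t0 /supportedP Du] /andP[t0' /supportedP Du'] eq_f.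
  have E i j : cell_col l m t u i 0 * cell_row l m t u j 0
             = cell_col l m t' u' i 0 * cell_row l m t' u' j 0.
    by apply: (addrI ((i == j)%:R)); rewrite -!fE // eq_f.
  congr (_, _); first by apply: invr_inj; have := E l m; rewrite !col_l !row_m !mul1r.
  apply/ffunP=> k; have [/norP[nltk ngtk]|] := boolP (~~ out k).
    by rewrite Du ?Du' ?negb_or ?nltk.
  rewrite negbK => /orP[ltkl|ltmk].
    by have := E k l; rewrite !row_l !col_lt // !mulrN1 => /oppr_inj.
  by have := E l k; rewrite !col_l !row_gt // !mul1r.
by rewrite cardsX cardsC1 card_supported card_ord_outside.
Qed.

End Counting.

(** * The sum of all transvections *)

Theorem theorem1p5 (R : realType) (q : nat) (F : finFieldType) (hq : #|F| = q)
    (n : nat) (hn : (2 <= n)%N) :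
  heckeD F n R[i] =
    ((n - 1)%:R * q%:R ^+ (n - 1) - qint R[i] q (n - 1))%:A
    + (q%:R - 1) *:
      (\sum_(i < n.-1.+1) \sum_(j < n.-1.+1 | (i < j)%N)
          q%:R ^+ (n - 1 - (j - i)) *: heckeT F n R[i] (tperm i j)).
Proof.
case: n hn => [//|n] _; rewrite subn1 /=.
have q_gt1 : (1 < q)%N by rewrite -hq; apply: card_finNzRing_gt1.
have q_gt0 := ltnW q_gt1.
pose P (p : 'I_n.+1 * 'I_n.+1) := (p.1 < p.2)%N.
pose w (p : 'I_n.+1 * 'I_n.+1) := @permGL F n.+1 (tperm p.1 p.2).
have scalar_part : (\sum_(m < n.+1) (q ^ n - q ^ m))%N%:R = n%:R * q%:R ^+ n - qint R[i] q n.
  have q1 : q%:R - 1 != 0 :> R[i] by rewrite subr_eq0 (eqr_nat _ q 1) gtn_eqF.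
  have qintE : qint R[i] q n = \sum_(m < n) q%:R ^+ m.
    by rewrite /qint subrX1 mulrAC divff // mul1r.
  have constE : n%:R * q%:R ^+ n = \sum_(m < n) q%:R ^+ n :> R[i].
    by rewrite sumr_const card_ord mulr_natl.
  rewrite big_ord_recr /= subnn addn0 qintE constE natr_sum -sumrB.
  by apply: eq_bigr => m _; rewrite natrB ?natrX // leq_pexp2l // ltnW.
rewrite /heckeD (@hecke_central_expand _ _ _ _ _ _ P w).
- rewrite card_transvections_borel hq scalar_part.
  apply: (congr1 (fun X => _ + X)); rewrite scaler_sumr.
  rewrite -(pair_big_dep predT (fun i j : 'I_n.+1 => (i < j)%N)
    (fun i j => #|transvections F n.+1 :&: (w (i, j) *: borel_group F n.+1)%g|%:R
       *: hecke_dcoset R[i] (borel_group F n.+1) (w (i, j)))) /=.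
  apply: eq_bigr => i _; rewrite scaler_sumr; apply: eq_bigr => j ltij.
  rewrite card_transvections_cell // hq scalerA; apply: (congr1 (fun x => x *: _)).
  by rewrite natrM natrX -subn1 natrB.
- move=> p ltp; apply/negP => /permGL_borel /permP/(_ p.1); rewrite tpermL perm1 => E.
  by move: ltp; rewrite /P E ltnn.
- move=> [i j] [k l]; rewrite /P /= => ltij ltkl /permGL_dcoset_inj eq_t.
  have := congr1 (fun s : 'S_n.+1 => s i) eq_t; rewrite /= tpermL.
  case: tpermP => [-> ->|eq_il eq_jk|_ _ eq_ji] //.
    by move: ltij ltkl; rewrite eq_il eq_jk => /ltn_trans lt /lt; rewrite ltnn.
  by rewrite eq_ji ltnn in ltij.
- exact: transvection_cover.
Qed.
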